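(* Suppose that $\nabla f$ is $L$-Lipschitz continuous and that $f(x)\ge f_{\mathrm{low}}$ for all $x\in\mathbb{R}^n$. Let $FE_{T(\epsilon)}$ be the total number of function evaluations performed by Algorithm 1 up to the $(T(\epsilon)-1)$-st iteration. Then $$FE_{T(\epsilon)}\le 2(n+1)\max\left\{1,\log_2\left(\frac{2n}{b s_0\ln(n)}\right),\log_2\left(\frac{2(\theta+1)^2}{1-2\theta}\frac{L}{\sigma_0}\right)\right\}\times\left[2\max\left\{2\sigma_0,\left[\frac{2n}{b s_0\ln(n)}\right]\sigma_0,\left[\frac{2(\theta+1)^2}{1-2\theta}\right]L\right\}(f(x_0)-f_{\mathrm{low}})\,\epsilon^{-2}\right].$$
   Context: Setting: $n\ge 2$, $f:\mathbb{R}^n\to\mathbb{R}$ is differentiable, $L>0$, $f_{\mathrm{low}}\in\mathbb{R}$, $\|\cdot\|$ is the Euclidean norm. Algorithm 1 (ZORO-FA). Inputs: $x_0\in\mathbb{R}^n$, $\epsilon\in(0,1)$, $\theta\in(0,1/2)$, $b\ge 1$, $\sigma_0>0$, an integer $s_0\ge1$ with $\lceil b s_0\ln(n)\rceil\le n/4$, and i.i.d. Rademacher random vectors $z_1,\dots,z_n\in\{-1,1\}^n$ (independent entries, $\pm1$ with equal probability), sampled once at the start. For integers $j\ge 0$ put $s_j=2^j s_0$, $\sigma_j=2^j\sigma_0$, $m_j=\lceil b s_j\ln(n)\rceil$. At iteration $k=0,1,2,\dots$, given $x_k$, for $j=0,1,2,\dots$ do the following. (i) If $m_j<n$: set $h_j=\frac{\theta}{11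 n\sigma_j}\epsilon$, $Z^{(j)}=\frac{1}{\sqrt{m_j}}[z_1\ \cdots\ z_{m_j}]^T\in\mathbb{R}^{m_j\times n}$, compute $y_k^{(j)}\in\mathbb{R}^{m_j}$ with entries $[y_k^{(j)}]_i=\frac{f(x_k+h_jz_i)-f(x_k)}{\sqrt{m_j}\,h_j}$, $i=1,\dots,m_j$, and let $g_k^{(j)}$ be the result of $\left\lceil\frac{\log(\theta/4)}{\log(0.5)}\right\rceil$ iterations of CoSaMP, started at $0$, applied to $\min_{\|g\|_0\le s_j}\|Z^{(j)}g-y_k^{(j)}\|_2$. (ii) If $m_j\ge n$: set $h_j=\frac{2\theta}{\sigma_j\sqrt n}\epsilon$ and let $g_k^{(j)}\in\mathbb{R}^n$ have entries $[g_k^{(j)}]_\ell=\frac{f(x_k+h_je_\ell)-f(x_k)}{h_j}$, $\ell=1,\dots,n$, with $e_\ell$ the standard basis vectors. (iii) Let $x_{k,j}^+=x_k-\frac1{\sigma_j}g_k^{(j)}$. If $f(x_k)-f(x_{k,j}^+)\ge\frac{1}{2\sigma_j}\epsilon^2$, set $j_k=j$, $x_{k+1}=x_{k,j_k}^+$ and go to iteration $k+1$; otherwise increase $j$ by one. CoSaMP for $\min_{\|v\|_0\le s}\|Zv-y\|_2$ ($\|v\|_0$ is the number of nonzero entries): given $v^\ell$, let $U$ be the union of the support of $v^\ell$ and the indices of the $2s$ largest-in-magnitude entries of $Z^T(y-Zv^\ell)$ (all indices if $2s\ge n$), let $u$ minimize $\|Zu-y\|_2$ over vectors supported in $U$, and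 let $v^{\ell+1}$ keep the $s$ largest-in-magnitude entries of $u$, setting the others to $0$. $T(\epsilon)=\inf\{k\in\mathbb{N}:\|\nabla f(x_k)\|\le\epsilon\}$. $FE_{T(\epsilon)}$ counts the evaluations of $f$ made in iterations $0,\dots,T(\epsilon)-1$ (at $x_k$, at the points $x_k+h_jz_i$ or $x_k+h_je_\ell$, and at the trial points $x_{k,j}^+$). *)

(* Defs.v *)
From HB Require Import structures.
From mathcomp Require Import all_boot all_order all_algebra.
From mathcomp Require Import all_classical all_reals all_analysis.

Set Implicit Arguments.
Unset Strict Implicit.
Unset Printing Implicit Defensive.
Import Order.TTheory GRing.Theory Num.Theory.
Import numFieldNormedType.Exports.

Local Open Scope classical_set_scope.
Local Open Scope ring_scope.

(* The norm [`|x|] of the library on matrices is the max-norm. *)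
Definition l2norm (R : realType) (n : nat) (x : 'cV[R]_n) : R :=
  Num.sqrt (\sum_(i < n) x i 0 ^+ 2).

Definition gradient (R : realType) (n : nat) (f : 'cV[R]_n -> R)
    (x : 'cV[R]_n) : 'cV[R]_n :=
  \col_i 'd f x (delta_mx i 0).

Definition log2 (R : realType) (x : R) : R := ln x / ln 2.

(* This is the ceiling only for [x > -1]; it is used for [x >= 0]. *)
Definition nat_ceil (R : realType) (x : R) : nat := `|Num.ceil x|%N.

Definition mutually_independent d (T : measurableType d) (R : realType)
    (P : probability T R) (I : finType) (X : I -> {RV P >-> R}) : Prop :=
  forall (J : {set I}) (B : I -> set R),
    (forall i, measurable (B i)) ->
    P [set w | forall i, i \in J -> B i (X i w)]
      = (\prod_(i in J) P (X i @^-1` B i))%E.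

Definition rademacher d (T : measurableType d) (R : realType)
    (P : probability T R) (X : {RV P >-> R}) : Prop :=
  [/\ forall w, X w = 1 \/ X w = -1,
      P [set w | X w = 1] = (2^-1)%:E
    & P [set w | X w = -1] = (2^-1)%:E].

(* [z i l] is the [l]-th entry of the [i]-th random vector. *)
Definition iid_rademacher_vectors d (T : measurableType d) (R : realType)
    (P : probability T R) (n : nat) (z : 'I_n -> 'I_n -> {RV P >-> R}) : Prop :=
  (forall i l, rademacher (z i l)) /\
  mutually_independent (fun il : 'I_n * 'I_n => z il.1 il.2).

Definition support_cv (R : realType) (n : nat) (v : 'cV[R]_n) : {set 'I_n} :=
  [set i | v i 0 != 0]%SET.

Definition largest_entries (R : realType) (n k : nat) (w : 'cV[R]_n)
    (S : {set 'I_n}) : Prop :=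
  #|S| = minn k n /\
  forall i j, i \in S -> j \notin S -> `|w j 0| <= `|w i 0|.

Definition least_squares_on (R : realType) (m n : nat) (Z : 'M[R]_(m, n))
    (y : 'cV[R]_m) (U : {set 'I_n}) (u : 'cV[R]_n) : Prop :=
  support_cv u \subset U /\
  forall w : 'cV[R]_n, support_cv w \subset U ->
    l2norm (Z *m u - y) <= l2norm (Z *m w - y).

Definition restrict_cv (R : realType) (n : nat) (S : {set 'I_n})
    (u : 'cV[R]_n) : 'cV[R]_n :=
  \col_i (if i \in S then u i 0 else 0).

(* Ties between entries of equal magnitude and non-unique least
   squares solutions may be resolved arbitrarily in CoSaMP, so that a step is a
   relation between successive iterates. *)
Definition cosamp_step (R : realType) (m n : nat) (Z : 'M[R]_(m, n))
    (y : 'cV[R]_m) (s : nat) (v v' : 'cV[R]_n) : Prop :=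
  exists (S S' : {set 'I_n}) (u : 'cV[R]_n),
    [/\ largest_entries (2 * s)%N (Z^T *m (y - Z *m v)) S,
        least_squares_on Z y (support_cv v :|: S)%SET u,
        largest_entries s u S'
      & v' = restrict_cv S' u].

Definition cosamp (R : realType) (m n : nat) (Z : 'M[R]_(m, n))
    (y : 'cV[R]_m) (s iters : nat) (g : 'cV[R]_n) : Prop :=
  exists v : nat -> 'cV[R]_n,
    [/\ v 0%N = 0,
        forall l, (l < iters)%N -> cosamp_step Z y s (v l) (v l.+1)
      & v iters = g].

Section ZoroFA.
Context {R : realType} {n : nat}.
Variables (f : 'cV[R]_n -> R) (eps theta b sigma0 : R) (s0 : nat).
Variable z : 'I_n -> 'cV[R]_n.

Definition zoro_s (j : nat) : nat := (2 ^ j * s0)%N.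

Definition zoro_sigma (j : nat) : R := 2 ^+ j * sigma0.

Definition zoro_m (j : nat) : nat := nat_ceil (b * (zoro_s j)%:R * ln n%:R).

Definition cosamp_iters : nat := nat_ceil (ln (theta / 4) / ln (2^-1)).

Definition h_sparse (j : nat) : R := theta / (11 * n%:R * zoro_sigma j) * eps.

Definition h_full (j : nat) : R :=
  2 * theta / (zoro_sigma j * Num.sqrt n%:R) * eps.

Definition sensing_mx (m : nat) (le_mn : (m <= n)%N) : 'M[R]_(m, n) :=
  \matrix_(i, l) (z (widen_ord le_mn i) l 0 / Num.sqrt m%:R).

Definition sensing_rhs (m : nat) (le_mn : (m <= n)%N) (h : R) (x : 'cV[R]_n) :
    'cV[R]_m :=
  \col_i ((f (x + h *: z (widen_ord le_mn i)) - f x) / (Num.sqrt m%:R * h)).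

Definition forward_difference (h : R) (x : 'cV[R]_n) : 'cV[R]_n :=
  \col_l ((f (x + h *: delta_mx l 0) - f x) / h).

Definition gradient_estimate (x : 'cV[R]_n) (j : nat) (g : 'cV[R]_n) : Prop :=
  (forall lt_mn : (zoro_m j < n)%N,
     cosamp (sensing_mx (ltnW lt_mn))
            (sensing_rhs (ltnW lt_mn) (h_sparse j) x)
            (zoro_s j) cosamp_iters g)
  /\ ((n <= zoro_m j)%N -> g = forward_difference (h_full j) x).

Definition trial_point (x : 'cV[R]_n) (j : nat) (g : 'cV[R]_n) : 'cV[R]_n :=
  x - (zoro_sigma j)^-1 *: g.

Definition accepted (x : 'cV[R]_n) (j : nat) (g : 'cV[R]_n) : bool :=
  eps ^+ 2 / (2 * zoro_sigma j) <= f x - f (trial_point x j g).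

Variables (x : nat -> 'cV[R]_n) (g : nat -> nat -> 'cV[R]_n).

(* The inner loop of iteration [k] reaches [j]: no smaller value was accepted. *)
Definition tried (k j : nat) : bool :=
  [forall i : 'I_j, ~~ accepted (x k) i (g k i)].

(* [x k] and [g k j] are the iterates and gradient estimates of an execution.
   [g k j] is irrelevant when [j] is not tried in iteration [k].  If no [j] is
   accepted in iteration [k], the execution never leaves it and [x k.+1] is
   irrelevant: [zoro_FE] below is then +oo, unless [hitting_time] is at most
   [k]. *)
Definition zoro_run (x0 : 'cV[R]_n) : Prop :=
  [/\ x 0%N = x0,
      forall k j, tried k j -> gradient_estimate (x k) j (g k j)
    & forall k j, tried k j -> accepted (x k) j (g k j) ->
        x k.+1 = trial_point (x k) j (g k j)].

Definition hitting_time : \bar R :=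
  ereal_inf [set (k%:R)%:E | k in [set k : nat | l2norm (gradient f (x k)) <= eps]].

(* One evaluation at [x k], then for every [j] tried [minn (zoro_m j) n] for
   the finite differences and one at the trial point. *)
Definition iteration_FE (k : nat) : \bar R :=
  (1 + \sum_(0 <= j <oo | tried k j) ((minn (zoro_m j) n).+1%:R)%:E)%E.

Definition zoro_FE : \bar R :=
  (\sum_(0 <= k <oo | ((k%:R)%:E < hitting_time)%E) iteration_FE k)%E.

End ZoroFA.

(* Main.v *)
Require Import Defs.
From mathcomp Require Import all_boot all_order all_algebra.
From mathcomp Require Import all_classical all_reals all_analysis.
From mathcomp Require Import ring lra.
Set Implicit Arguments.
Unset Strict Implicit.
Unset Printing Implicit Defensive.
Import Order.TTheory GRing.Theory Num.Theory.
Import numFieldNormedType.Exports.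
Local Open Scope ring_scope.

(* Only the full finite difference steps (m_j >= n) matter: since the gradient
   is L-Lipschitz, such a step has error at most theta * eps once sigma_j >= L,
   and it is accepted at a point with gradient norm > eps once
   sigma_j >= (1 + theta)^2 L / (1 - 2 theta), whatever CoSaMP returned before.
   With A = 2n / (b s0 ln n) and B = 2 (theta + 1)^2 L / ((1 - 2 theta) sigma0),
   the least J at which both conditions hold satisfies 2^J <= max (A, B), so
   that every accepted sigma_j is at most max (A, B) sigma0 and telescoping the
   decreases eps^2 / (2 sigma_j) bounds the number of iterations.  An iteration
   costs at most 1 + (J + 1)(n + 1) evaluations; the assumption m_0 <= n / 4
   yields A >= 8, hence M := max (1, log2 A, log2 B) >= 3, and with J <= M this
   cost is at most 2 (n + 1) M. *)

(** * Inner product and Euclidean norm *)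

Definition dotcv {R : realType} {n : nat} (u v : 'cV[R]_n) : R :=
  \sum_(i < n) u i 0 * v i 0.

Section Euclidean.
Context {R : realType} {n : nat}.
Implicit Types u v w : 'cV[R]_n.

Lemma dotcvC u v : dotcv u v = dotcv v u.
Proof. by apply: eq_bigr => i _; rewrite mulrC. Qed.

Lemma dotcvDl u v w : dotcv (u + v) w = dotcv u w + dotcv v w.
Proof. by rewrite -big_split; apply: eq_bigr => i _; rewrite mxE mulrDl. Qed.

Lemma dotcvZl c u v : dotcv (c *: u) v = c * dotcv u v.
Proof. by rewrite mulr_sumr; apply: eq_bigr => i _; rewrite mxE mulrA. Qed.

Lemma dotcvDr u v w : dotcv w (u + v) = dotcv w u + dotcv w v.
Proof. by rewrite !(dotcvC w) dotcvDl. Qed.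

Lemma dotcvZr c u v : dotcv u (c *: v) = c * dotcv u v.
Proof. by rewrite !(dotcvC u) dotcvZl. Qed.

Lemma dotcv_ge0 u : 0 <= dotcv u u.
Proof. by apply: sumr_ge0 => i _; rewrite -expr2 sqr_ge0. Qed.

Lemma l2norm_ge0 u : 0 <= l2norm u. Proof. exact: sqrtr_ge0. Qed.

Lemma l2norm_sqr u : l2norm u ^+ 2 = dotcv u u.
Proof.
rewrite /l2norm sqr_sqrtr; last by apply: sumr_ge0 => i _; rewrite sqr_ge0.
by apply: eq_bigr => i _; rewrite expr2.
Qed.

Lemma l2normZ c u : l2norm (c *: u) = `|c| * l2norm u.
Proof.
apply/eqP; rewrite -(eqrXn2 (n := 2)) ?mulr_ge0 ?l2norm_ge0 //.
by rewrite exprMn !l2norm_sqr real_normK ?num_real // dotcvZl dotcvZr mulrA.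
Qed.

Lemma dotcv_delta u i : dotcv u (delta_mx i 0) = u i 0.
Proof.
rewrite /dotcv (bigD1 i) //= big1 ?addr0; first by rewrite mxE !eqxx mulr1.
by move=> j /negPf ji; rewrite mxE ji mulr0.
Qed.

Lemma dotcv_le_l2norm u v : `|dotcv u v| <= l2norm u * l2norm v.
Proof.
rewrite -(ler_pXn2r (n := 2)) ?nnegrE ?mulr_ge0 ?l2norm_ge0 //.
rewrite real_normK ?num_real // exprMn !l2norm_sqr.
have [v0|v_neq0] := eqVneq (dotcv v v) 0.
  have /psumr_eq0P v_eq0 : \sum_(i < n) v i 0 * v i 0 = 0 by [].
  rewrite [dotcv u v]big1 ?expr0n ?mulr_ge0 ?dotcv_ge0 //= => i _.
  have /eqP : v i 0 * v i 0 = 0.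
    by apply: v_eq0 => // j _; rewrite -expr2 sqr_ge0.
  by rewrite mulf_eq0 orbb => /eqP ->; rewrite mulr0.
have v_gt0 : 0 < dotcv v v by rewrite lt_def v_neq0 dotcv_ge0.
(* Cauchy-Schwarz: with [q = dotcv v v] and [p = dotcv u v], the squared norm of [q u - p v] equals
   [q (dotcv u u * q - p ^ 2)], and [q > 0] can be cancelled. *)
have := dotcv_ge0 (dotcv v v *: u + (- dotcv u v) *: v).
rewrite !(dotcvDl, dotcvDr, dotcvZl, dotcvZr) (dotcvC v u).
set a := dotcv u u; set p := dotcv u v; set q := dotcv v v.
rewrite [leRHS](_ : _ = q * (a * q - p ^+ 2)); last by rewrite expr2; ring.
by rewrite pmulr_rge0 // subr_ge0.
Qed.

Lemma l2norm_le_const (c : R) u : 0 <= c -> (forall i, `|u i 0| <= c) ->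
  l2norm u <= c * Num.sqrt n%:R.
Proof.
move=> c_ge0 u_le.
rewrite -(ler_pXn2r (n := 2)) ?nnegrE ?mulr_ge0 ?l2norm_ge0 ?sqrtr_ge0 //.
rewrite l2norm_sqr exprMn sqr_sqrtr ?ler0n // /dotcv.
apply: (@le_trans _ _ (\sum_(i < n) c ^+ 2)).
  apply: ler_sum => i _; rewrite -expr2 -[u i 0 ^+ 2]real_normK ?num_real //.
  by rewrite ler_pXn2r ?nnegrE.
by rewrite sumr_const card_ord mulr_natr.
Qed.

End Euclidean.

(** * Functions with Lipschitz gradient *)

Section SmoothFunction.
Context {R : realType} {n : nat}.
Variables (f : 'cV[R]_n -> R) (L : R).
Hypothesis f_diff : forall x : 'cV[R]_n, differentiable f x.
Implicit Types u v x : 'cV[R]_n.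

Lemma diff_gradient x v : 'd f x v = dotcv (gradient f x) v.
Proof.
have {1}-> : v = \sum_(i < n) v i 0 *: delta_mx i 0.
  rewrite {1}[v]matrix_sum_delta; apply: eq_bigr => i _.
  by rewrite big_ord1.
rewrite linear_sum; apply: eq_bigr => i _.
by rewrite linearZ mxE /= mulrC.
Qed.

(** The difference quotients at [t] along the line are exactly those of [f] at [x + t v] in
    direction [v]. *)
Lemma is_derive_line x v (t : R) :
  is_derive t 1 (fun s : R => f (x + s *: v))
    (dotcv (gradient f (x + t *: v)) v).
Proof.
have quotE : (fun h : R => h^-1 *: (((fun s : R => f (x + s *: v)) \o shift t)
       (h *: 1) - f (x + t *: v))) =
   (fun h : R => h^-1 *: ((f \o shift (x + t *: v)) (h *: v) - f (x + t *: v))).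
  apply/funext => h /=; congr (_ *: (f _ - _)).
  by rewrite [h *: 1]mulr1 scalerDl addrCA.
apply: DeriveDef.
  rewrite /derivable quotE; exact: (diff_derivable (f_diff _)).
rewrite /derive quotE -diff_gradient.
exact: (deriveE _ (f_diff _)).
Qed.

Hypothesis grad_lip : forall u v,
  l2norm (gradient f u - gradient f v) <= L * l2norm (u - v).

(* The sign [s] gives the upper and the lower bound at once. *)
Lemma quadratic_bound (s : R) x v : `|s| = 1 ->
  s * (f (x + v) - f x - dotcv (gradient f x) v) <= L / 2 * l2norm v ^+ 2.
Proof.
move=> s1; set G := dotcv (gradient f x) v; set q := l2norm v ^+ 2.
(* [phi 1 - phi 0] is the left side minus the right side of the claim. By the mean value theorem it
   equals [dphi c] with [0 < c < 1], and [dphi c <= 0] by Cauchy-Schwarz and the Lipschitz bound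
   between [x + c v] and [x]. *)
pose dphi (t : R) := s * (dotcv (gradient f (x + t *: v)) v - G) - L * q * t.
pose phi (t : R) := s * (f (x + t *: v) - G * t) - L / 2 * q * t ^+ 2.
have dphiP (t : R) : is_derive t 1 phi (dphi t).
  pose F : R -> R := fun r => f (x + r *: v).
  have dF : is_derive t 1 F (dotcv (gradient f (x + t *: v)) v).
    exact: is_derive_line.
  have -> : phi = s \*: (F - G \*: id) - (L / 2 * q) \*: (id ^+ 2 : R -> R).
    by apply/funext.
  apply: is_derive_eq; rewrite /dphi /GRing.scale /=.
  by rewrite expr1; field.
have phi_cont : {within [set` `[0, 1]%R], continuous phi}%classic.
  by apply: derivable_within_continuous => t _; case: (dphiP t).
have [c] := @MVT R phi dphi 0 1 ltr01 (fun t _ => dphiP t) phi_cont.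
rewrite in_itv /= => /andP[c_gt0 _].
have -> : phi 1 - phi 0 = s * (f (x + v) - f x - G) - L / 2 * q.
  by rewrite /phi scale1r scale0r addr0; field.
rewrite subr0 mulr1 -subr_le0 => ->.
rewrite /dphi subr_le0.
have -> : dotcv (gradient f (x + c *: v)) v - G =
    dotcv (gradient f (x + c *: v) - gradient f x) v.
  by rewrite -[in RHS]scaleN1r dotcvDl dotcvZl mulN1r.
apply: le_trans (ler_norm _) _; rewrite normrM s1 mul1r.
apply: le_trans (dotcv_le_l2norm _ _) _.
rewrite /q expr2 mulrAC mulrA ler_wpM2r ?l2norm_ge0 //.
apply: le_trans (grad_lip _ _) _.
by rewrite addrC addKr l2normZ gtr0_norm // mulrA.
Qed.

(** The quadratic bound along [h e_i], taken with both signs and divided by [h], bounds each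
    coordinate of the error by [L h / 2]. *)
Lemma forward_difference_error (h : R) x : 0 <= L -> 0 < h ->
  l2norm (forward_difference f h x - gradient f x)
    <= L * h / 2 * Num.sqrt n%:R.
Proof.
move=> L_ge0 h_gt0.
apply: l2norm_le_const => [|i]; first by rewrite !mulr_ge0 // ltW.
have := @quadratic_bound 1 x (h *: delta_mx i 0) (normr1 _).
have := @quadratic_bound (-1) x (h *: delta_mx i 0) (normrN1 _).
have -> : l2norm (h *: delta_mx i 0 : 'cV[R]_n) ^+ 2 = h ^+ 2.
  by rewrite l2norm_sqr dotcvZl dotcvZr dotcv_delta mxE !eqxx mulr1 expr2.
have -> : (forward_difference f h x - gradient f x) i 0 =
    (f (x + h *: delta_mx i 0) - f x) / h - gradient f x i 0 by rewrite !mxE.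
rewrite dotcvZr dotcv_delta mul1r.
set D := f _ - f x; set G := gradient f x i 0 => lo up.
rewrite ler_norml lerBrDr lerBlDr.
rewrite ler_pdivlMr // ler_pdivrMr //.
by apply/andP; split; nra.
Qed.

(** Write [u = G + e] and [a] for the norm of [G]. The linear term gains at least
    [s (1 - theta) a^2], since the product of [G] and [e] is at least [- theta a^2]. The quadratic
    term costs at most [s^2 L (1 + theta)^2 a^2 / 2], hence at most [s (1 - 2 theta) a^2 / 2]. The
    difference is [s a^2 / 2]. *)
Lemma sufficient_decrease (theta s : R) x u :
  0 < s -> 0 <= theta -> 0 <= L -> L * (1 + theta) ^+ 2 * s <= 1 - 2 * theta ->
  l2norm (u - gradient f x) <= theta * l2norm (gradient f x) ->
  s / 2 * l2norm (gradient f x) ^+ 2 <= f x - f (x - s *: u).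
Proof.
move=> s_gt0 th_ge0 L_ge0 s_small.
set G := gradient f x; set a := l2norm G.
have a_ge0 : 0 <= a := l2norm_ge0 _.
have [e ->] : exists e, u = G + e by exists (u - G); rewrite addrC subrK.
rewrite addrC addKr => e_le.
have := @quadratic_bound 1 x (- (s *: (G + e))) (normr1 _).
rewrite -scaleNr l2normZ normrN gtr0_norm // exprMn l2norm_sqr -/G.
rewrite dotcvZr !(dotcvDl, dotcvDr) (dotcvC e G) -!l2norm_sqr -/a.
have := dotcv_le_l2norm G e; rewrite -/a ler_norml => /andP[].
set p := dotcv G e; set c := l2norm e in e_le *.
have c_ge0 : 0 <= c := l2norm_ge0 _.
set D := f (x + _) => p_ge p_le.
have ac : a * c <= theta * a ^+ 2.
  by rewrite expr2 mulrCA ler_wpM2l.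
have cc : c ^+ 2 <= theta ^+ 2 * a ^+ 2.
  by rewrite -exprMn ler_pXn2r ?nnegrE // mulr_ge0.
have nrm : a ^+ 2 + p + (p + c ^+ 2) <= (1 + theta) ^+ 2 * a ^+ 2 by nra.
have key : L * s ^+ 2 * (a ^+ 2 + p + (p + c ^+ 2))
    <= s * (1 - 2 * theta) * a ^+ 2.
  apply: (@le_trans _ _ (L * s ^+ 2 * ((1 + theta) ^+ 2 * a ^+ 2))).
    by rewrite ler_wpM2l // mulr_ge0 // sqr_ge0.
  rewrite (_ : _ * _ = L * (1 + theta) ^+ 2 * s * (s * a ^+ 2)); last by ring.
  rewrite (_ : s * _ * _ = (1 - 2 * theta) * (s * a ^+ 2)); last by ring.
  by rewrite ler_wpM2r // mulr_ge0 ?sqr_ge0 // ltW.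
have sp : - (theta * (s * a ^+ 2)) <= s * p.
  by rewrite mulrCA -mulrN ler_pM2l //; nra.
nra.
Qed.

End SmoothFunction.

(** * Powers of two, and sums of extended reals *)

Section Auxiliary.
Context {R : realType}.
Implicit Types x t : R.

Lemma nat_ceil_ge x : 0 <= x -> x <= (nat_ceil x)%:R.
Proof.
move=> x_ge0; apply: le_trans (ceil_ge x) _.
by rewrite /nat_ceil natr_absz ger0_norm // ceil_ge0 (lt_le_trans _ x_ge0).
Qed.

(** Take the least [j] with [t <= 2 ^ j]. Either [j = 0], which accounts for the [1], or minimality
    gives [2 ^ (j - 1) < t]. *)
Lemma pow2_bracket t : exists j : nat, t <= 2 ^+ j <= Num.max 1 (2 * t).
Proof.
have ex : exists j : nat, t <= 2 ^+ j.
  by exists (Num.bound t); exact/ltW/upper_nthrootP.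
case: (ex_minnP ex) => -[|j] tj jmin; [exists 0%N|exists j.+1]; rewrite tj /=.
  by rewrite le_max expr0 lexx.
rewrite le_max exprS ler_pM2l ?ltr0n // [X in _ || X]ltW ?orbT //.
by rewrite ltNge; apply/negP => /jmin; rewrite ltnn.
Qed.

Lemma le_log2 (j : nat) x : 2 ^+ j <= x -> j%:R <= log2 x.
Proof.
move=> jx; have ln2_gt0 : 0 < ln (2 : R) by rewrite ln_gt0 // ltr1n.
rewrite ler_pdivlMr // mulr_natl -lnXn ?ltr0n // ler_ln //.
  by rewrite posrE exprn_gt0.
by rewrite posrE (lt_le_trans _ jx) // exprn_gt0.
Qed.

Local Open Scope ereal_scope.

Lemma nneseries_le (P : pred nat) (u : nat -> \bar R) (c : \bar R) :
  (forall i, 0 <= u i) ->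
  (forall N, \sum_(0 <= i < N | P i) u i <= c) ->
  \sum_(0 <= i <oo | P i) u i <= c.
Proof.
move=> u_ge0 u_le; apply: lime_le; first exact: is_cvg_nneseries.
by apply: nearW => N; exact: u_le.
Qed.

Lemma sum_le_decrease (P : pred nat) (u : nat -> \bar R) (v : nat -> R)
    (low C : R) (N : nat) :
  (0 <= C)%R -> (forall k, P k.+1 -> P k) ->
  (forall k, P k -> u k <= (C * (v k - v k.+1))%:E) ->
  (forall k, (low <= v k)%R) ->
  \sum_(0 <= k < N | P k) u k <= (C * (v 0%N - low))%:E.
Proof.
move=> C_ge0 P_down u_le v_low.
(* The telescoped sum ends at [k = N] while [P] holds. Once [P] fails it fails for good, the sum no
   longer grows, and the old [k] is kept. *)
have [k [k_le _]] : exists k,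
    \sum_(0 <= i < N | P i) u i <= (C * (v 0%N - v k))%:E /\ (P N -> k = N).
  elim: N => [|N [k [k_le kN]]].
    by exists 0%N; rewrite big_geq // subrr mulr0.
  rewrite big_mkcond big_nat_recr //= -big_mkcond /=.
  case: ifPn => [PN|NPN].
    exists N.+1; split=> //; rewrite kN // in k_le.
    apply: le_trans (leeD k_le (u_le _ PN)) _.
    by rewrite -EFinD lee_fin -mulrDr addrA subrK.
  by exists k; split; [rewrite adde0|move/P_down => PN; rewrite PN in NPN].
apply: le_trans k_le _.
by rewrite lee_fin ler_wpM2l // lerD2l lerN2.
Qed.

End Auxiliary.

(** * Acceptance and evaluation count along a run *)

Section ZoroFA.
Context {R : realType} {n : nat}.
Variables (f : 'cV[R]_n -> R) (L eps theta b sigma0 : R) (s0 : nat).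
Variable z : 'I_n -> 'cV[R]_n.
Hypotheses (f_diff : forall x : 'cV[R]_n, differentiable f x) (L_gt0 : 0 < L).
Hypotheses (eps_gt0 : 0 < eps) (theta_gt0 : 0 < theta).
Hypothesis (theta_lt : theta < 1 / 2).
Hypothesis sigma0_gt0 : 0 < sigma0.
Hypothesis grad_lip : forall u v : 'cV[R]_n,
  l2norm (gradient f u - gradient f v) <= L * l2norm (u - v).

Let sigma := zoro_sigma sigma0.
Let m := zoro_m (n := n) b s0.

Lemma zoro_sigma_gt0 j : 0 < sigma j.
Proof. by rewrite mulr_gt0 // exprn_gt0. Qed.

Lemma zoro_sigma_le i j : (i <= j)%N -> sigma i <= sigma j.
Proof. by move=> ij; rewrite ler_pM2r // ler_weXn2l // ler1n. Qed.

Lemma full_difference_accepted (x g : 'cV[R]_n) (j : nat) : (0 < n)%N ->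
  gradient_estimate f eps theta b sigma0 s0 z x j g ->
  eps < l2norm (gradient f x) -> (n <= m j)%N ->
  L * (1 + theta) ^+ 2 <= (1 - 2 * theta) * sigma j ->
  accepted f eps sigma0 x j g.
Proof.
move=> n_gt0 [_ gE] eps_lt nm sigma_ge.
have {gE} g_def := gE nm; have sg := zoro_sigma_gt0 j.
have sqn : 0 < Num.sqrt n%:R :> R by rewrite sqrtr_gt0 ltr0n.
have h_gt0 : 0 < h_full (n := n) eps theta sigma0 j.
  by rewrite mulr_gt0 // divr_gt0 ?mulr_gt0.
(* This follows from [1 - 2 theta <= 1 <= (1 + theta)^2]. *)
have L_sigma : L <= sigma j.
  have L_le : L * (1 - 2 * theta) <= L * (1 + theta) ^+ 2.
    by rewrite ler_pM2l //; move: theta_gt0; nra.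
  have := le_trans L_le sigma_ge; rewrite [leRHS]mulrC ler_pM2r //.
  by move: theta_lt; lra.
have err : l2norm (g - gradient f x) <= theta * l2norm (gradient f x).
  rewrite g_def.
  apply: le_trans (forward_difference_error f_diff grad_lip _ (ltW L_gt0) h_gt0) _.
  apply: (@le_trans _ _ (theta * eps)); last by rewrite ler_pM2l // ltW.
  (* [h_full] is chosen so that the error bound [L h sqrt n / 2] becomes [theta eps] times
     [L / sigma j]. *)
  rewrite /h_full -/(sigma j) (_ : _ * _ = theta * eps * (L / sigma j)); last first.
    by field; rewrite !gt_eqF.
  apply: ler_piMr; first by rewrite mulr_ge0 ?ltW.
  by rewrite ler_pdivrMr // mul1r.
have := sufficient_decrease f_diff grad_lip
  (theta := theta) (s := (sigma j)^-1) (x := x) (u := g).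
rewrite invr_gt0 ler_pdivrMr // => /(_ sg (ltW theta_gt0) (ltW L_gt0) sigma_ge err).
apply: le_trans; rewrite (_ : _ / _ = (sigma j)^-1 / 2 * eps ^+ 2); last first.
  by rewrite -/(sigma j); field; rewrite gt_eqF.
apply: ler_wpM2l; first by rewrite divr_ge0 ?invr_ge0 ?ltW.
by rewrite ler_pXn2r ?nnegrE ?l2norm_ge0 // ltW.
Qed.

Variables (x : nat -> 'cV[R]_n) (g : nat -> nat -> 'cV[R]_n) (x0 : 'cV[R]_n).
Hypothesis run : zoro_run f eps theta b sigma0 s0 z x g x0.

Lemma tried_before_accepted k i j :
  tried f eps sigma0 x g k i -> accepted f eps sigma0 (x k) j (g k j) ->
  (i <= j)%N.
Proof.
move=> /forallP ki kj; rewrite leqNgt; apply/negP => ji.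
by have := ki (Ordinal ji); rewrite /= kj.
Qed.

(** Either level [J] is tried, and then its finite difference step is accepted, or an earlier
    acceptance prevents this. The least accepted level is one that is tried. *)
Lemma zoro_accepts k J : (0 < n)%N ->
  eps < l2norm (gradient f (x k)) -> (n <= m J)%N ->
  L * (1 + theta) ^+ 2 <= (1 - 2 * theta) * sigma J ->
  exists j, [/\ (j <= J)%N, tried f eps sigma0 x g k j
    & accepted f eps sigma0 (x k) j (g k j)].
Proof.
move=> n_gt0 eps_lt nm sigma_ge; have [_ run_g _] := run.
have [i acci iJ] : exists2 i, accepted f eps sigma0 (x k) i (g k i) & (i <= J)%N.
  have [trJ|] := boolP (tried f eps sigma0 x g k J).
    exists J => //; apply: full_difference_accepted => //; exact: run_g.
  rewrite negb_forall => /existsP[i]; rewrite negbK => acci.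
  by exists i => //; exact: ltnW.
have ex : exists i, accepted f eps sigma0 (x k) i (g k i) by exists i.
case: (ex_minnP ex) => j accj jmin; exists j; split=> //.
  exact: leq_trans (jmin _ acci) iJ.
by apply/forallP => l; apply/negP => /jmin; rewrite leqNgt ltn_ord.
Qed.

Lemma iteration_FE_le k j :
  accepted f eps sigma0 (x k) j (g k j) ->
  (iteration_FE f eps b sigma0 s0 x g k <= (1 + j.+1 * n.+1)%:R%:E)%E.
Proof.
move=> accj; rewrite natrD EFinD leeD2l //.
apply: nneseries_le => [i|N]; first by rewrite lee_fin.
rewrite sumEFin lee_fin -natr_sum ler_nat.
(* No level beyond [j] is tried, so at most [j + 1] terms count, each at most [n + 1]. The minimum
   with [N] makes the bound inductive in [N]. *)
apply: (@leq_trans (minn N j.+1 * n.+1)); last by rewrite leq_mul // geq_minr.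
elim: N => [|N IH]; first by rewrite big_geq.
rewrite big_mkcond big_nat_recr //= -big_mkcond /=.
have [/tried_before_accepted/(_ accj) Nj|_] := boolP (tried _ _ _ _ _ _ _).
  move: IH; rewrite (minn_idPl (leq_trans Nj (leqnSn j))) (minn_idPl (_ : N < j.+1)%N) //.
  by move=> IH; rewrite mulSnr leq_add // ltnS geq_minr.
rewrite addn0; apply: leq_trans IH _.
by rewrite leq_mul // leq_min geq_minr (leq_trans (geq_minl _ _)).
Qed.

Lemma lt_hitting_time k :
  ((k%:R)%:E < hitting_time f eps x)%E -> eps < l2norm (gradient f (x k)).
Proof.
move=> k_lt; rewrite ltNge; apply/negP => gk.
have : (hitting_time f eps x <= k%:R%:E)%E.
  by apply: ereal_inf_lbound; exists k.
by rewrite leNgt k_lt.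
Qed.

(** Before the hitting time an iteration costs at most [K] and lowers [f] by at least
    [eps^2 / (2 S)]. Its cost is thus at most [K] times the decrease divided by this quantity, and
    the decreases telescope. *)
Lemma zoro_FE_le (J : nat) (K S flow : R) : (0 < n)%N ->
  (forall u, flow <= f u) ->
  (n <= m J)%N -> L * (1 + theta) ^+ 2 <= (1 - 2 * theta) * sigma J ->
  (1 + J.+1 * n.+1)%:R <= K -> sigma J <= S ->
  (zoro_FE f eps b sigma0 s0 x g <=
   (K * (2 * S * (f x0 - flow) * eps ^- 2))%:E)%E.
Proof.
move=> n_gt0 f_low nm sigma_ge K_ge S_ge; have [x0E _ run_x] := run.
have S_gt0 : 0 < S := lt_le_trans (zoro_sigma_gt0 J) S_ge.
have K_ge0 : 0 <= K := le_trans (ler0n _ _) K_ge.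
rewrite -x0E (_ : K * _ = K * (2 * S) * eps ^- 2 * (f (x 0%N) - flow)); last by ring.
apply: nneseries_le => [k|N].
  by rewrite adde_ge0 // nneseries_ge0.
apply: (@sum_le_decrease R _ _ (fun k => f (x k))) => //.
- by rewrite !mulr_ge0 // ?invr_ge0 ?exprn_ge0 // ltW.
- by move=> k; apply: le_lt_trans; rewrite lee_fin ler_nat.
move=> k /lt_hitting_time eps_lt.
have [j [jJ trj accj]] := zoro_accepts n_gt0 eps_lt nm sigma_ge.
apply: le_trans (iteration_FE_le accj) _; rewrite lee_fin.
apply: (@le_trans _ _ K).
  by apply: le_trans K_ge; rewrite ler_nat leq_add2l leq_mul // ltnS.
have q_gt0 : 0 < eps ^+ 2 / (2 * S) by rewrite divr_gt0 ?exprn_gt0 ?mulr_gt0.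
rewrite (_ : _ * (_ - _) =
    K * ((f (x k) - f (x k.+1)) / (eps ^+ 2 / (2 * S)))); last first.
  by field; rewrite !gt_eqF.
apply: ler_peMr => //; rewrite ler_pdivlMr // mul1r.
have := accj; rewrite /accepted -(run_x _ _ trj accj); apply: le_trans.
apply: ler_wpM2l; first by rewrite exprn_ge0 // ltW.
rewrite lef_pV2 ?posrE ?mulr_gt0 ?zoro_sigma_gt0 // ler_pM2l //.
exact: le_trans (zoro_sigma_le jJ) S_ge.
Qed.

End ZoroFA.

(** * The level [J] and the explicit constants *)

Theorem corollary2
  (R : realType) (n : nat) (n_ge2 : (2 <= n)%N)
  (f : 'cV[R]_n -> R) (f_diff : forall x : 'cV[R]_n, differentiable f x)
  (L : R) (L_gt0 : 0 < L) (flow : R)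
  (eps : R) (eps_gt0 : 0 < eps) (eps_lt1 : eps < 1)
  (theta : R) (theta_gt0 : 0 < theta) (theta_lt : theta < 1 / 2)
  (b : R) (b_ge1 : 1 <= b)
  (sigma0 : R) (sigma0_gt0 : 0 < sigma0)
  (s0 : nat) (s0_ge1 : (1 <= s0)%N)
  (s0_small : (nat_ceil (b * s0%:R * ln n%:R))%:R <= n%:R / 4 :> R)
  (d : measure_display) (Omega : measurableType d) (P : probability Omega R)
  (z : 'I_n -> 'I_n -> {RV P >-> R})
  (z_iid : iid_rademacher_vectors z)
  (x0 : 'cV[R]_n)
  (x : Omega -> nat -> 'cV[R]_n)
  (g : Omega -> nat -> nat -> 'cV[R]_n)
  (run : forall w : Omega,
     zoro_run f eps theta b sigma0 s0 (fun i => \col_l z i l w) (x w) (g w) x0)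
  (grad_lip : forall u v : 'cV[R]_n,
     l2norm (gradient f u - gradient f v) <= L * l2norm (u - v))
  (f_low : forall u : 'cV[R]_n, flow <= f u) :
  forall w : Omega,
  (zoro_FE f eps b sigma0 s0 (x w) (g w) <=
   (2 * (n%:R + 1)
    * Num.max 1 (Num.max
        (log2 (2 * n%:R / (b * s0%:R * ln n%:R)))
        (log2 (2 * (theta + 1) ^+ 2 / (1 - 2 * theta) * (L / sigma0))))
    * (2 * Num.max (2 * sigma0) (Num.max
          (2 * n%:R / (b * s0%:R * ln n%:R) * sigma0)
          (2 * (theta + 1) ^+ 2 / (1 - 2 * theta) * L))
       * (f x0 - flow) * eps ^- 2))%:E)%E.
Proof.
move=> w; set c : R := b * s0%:R * ln n%:R in s0_small *.
have n_gt0 : (0 < n)%N by exact: leq_trans n_ge2.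
have nR_gt0 : 0 < n%:R :> R by rewrite ltr0n.
have b_gt0 : 0 < b := lt_le_trans ltr01 b_ge1.
have c_gt0 : 0 < c by rewrite !mulr_gt0 ?ltr0n // ln_gt0 // ltr1n.
have th_gt0 : 0 < 1 - 2 * theta by lra.
set A := 2 * n%:R / c; set B := 2 * (theta + 1) ^+ 2 / (1 - 2 * theta).
have B_gt0 : 0 < B by rewrite divr_gt0 // mulr_gt0 // exprn_gt0 // addr_gt0.
have A_ge8 : 2 ^+ 3 <= A.
  have c_le : c <= n%:R / 4 := le_trans (nat_ceil_ge (ltW c_gt0)) s0_small.
  by rewrite ler_pdivlMr //; lra.
have logA_ge3 : 3 <= log2 A by exact: le_log2 A_ge8.
(* As [m_J] is the ceiling of [2 ^ J * c], the first threshold ensures [m_J >= n]; the second is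
   [(1 + theta)^2 L / ((1 - 2 theta) sigma0)], the acceptance condition. Doubling them gives [A] and
   [B * (L / sigma0)]. *)
have [J /andP[J_ge J_le]] := pow2_bracket (Num.max (n%:R / c) (B / 2 * (L / sigma0))).
move: J_ge; rewrite ge_max => /andP[J_geA J_geB].
have {}J_le : 2 ^+ J <= Num.max A (B * (L / sigma0)).
  apply: le_trans J_le _; rewrite ge_max; apply/andP; split.
    (* The [1] in the bracket is absorbed by [A >= 8]. *)
    by rewrite le_max (le_trans _ A_ge8) // exprn_ege1 // ler1n.
  rewrite maxr_pMr // [2 * (_ / c)]mulrA -/A.
  by rewrite (_ : 2 * (B / 2 * _) = B * (L / sigma0)) //; field; rewrite gt_eqF.
have J_log : J%:R <= Num.max (log2 A) (log2 (B * (L / sigma0))).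
  rewrite le_max; move: J_le; rewrite le_max => /orP[] /le_log2 -> //.
  by rewrite orbT.
apply: (zoro_FE_le f_diff L_gt0 eps_gt0 theta_gt0 theta_lt sigma0_gt0
  grad_lip (run w) (J := J) n_gt0 f_low).
- rewrite -(ler_nat R); apply: le_trans (nat_ceil_ge _).
    rewrite natrM natrX.
    rewrite (_ : b * _ * _ = 2 ^+ J * c); last by rewrite /c; ring.
    by rewrite -ler_pdivrMr.
  by rewrite !mulr_ge0 ?(ltW b_gt0) ?ln_ge0 ?ler1n.
- rewrite /zoro_sigma [leRHS]mulrC -!ler_pdivrMr //.
  apply: le_trans J_geB; rewrite le_eqVlt; apply/orP; left; apply/eqP.
  by rewrite /B; field; rewrite !gt_eqF.
- rewrite natrD natrM -!natr1.
  set M := Num.max 1 _; set a : R := n%:R + 1.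
  have M_ge3 : 3 <= M by rewrite !le_max logA_ge3 orbT.
  have M_geJ : J%:R <= M by rewrite le_max J_log orbT.
  have a_ge1 : 1 <= a by rewrite lerDr.
  (* [1 + (J + 1) a <= (M + 2) a <= 2 a M], by [a >= 1], [J <= M] and [M >= 3]. *)
  nra.
- rewrite le_max; apply/orP; right.
  (* With [B * L] written as [B * (L / sigma0) * sigma0], the factor [sigma0] comes out of the
     maximum, leaving the bound on [2 ^ J]. *)
  rewrite -[B * L](mulfVK (lt0r_neq0 sigma0_gt0)) -[B * L / _]mulrA.
  by rewrite -maxr_pMl ?ler_pM2r // ltW.
Qed.
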